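(* There exists an analytic orientation-preserving diffeomorphism $f$ of $\mathbb{S}^1$ with rotation number $0$, which is $C^k$-distorted for every integer $k\geq 1$, and which has exactly one fixed point $x\in\mathbb{S}^1$, at which $f''(x)\neq 0$.
   Context: $\mathbb{S}^1$ is $[0,1]$ with endpoints identified (i.e. $\mathbb{R}/\mathbb{Z}$); derivatives are taken in the standard (angular) coordinate. $\mathrm{Diff}_+^k(\mathbb{S}^1)$ is the group (under composition) of orientation-preserving $C^k$ diffeomorphisms of $\mathbb{S}^1$, a Polish group with the uniform $C^k$ topology. A pseudometric $d$ on a topological group $G$ is maximal if it is continuous, right-invariant, and for every continuous right-invariant pseudometric $\rho$ on $G$ there are constants $K,C$ with $\rho\le K\cdot d+C$. Any two maximal pseudometrics on $G$ are quasi-isometrically equivalent, and the groups $\mathrm{Diff}_+^k(\mathbb{S}^1)$ admit maximal pseudometrics. For $G$ with a maximal pseudometric $d$, an element $f\in G$ is distorted in $G$ if the inclusion $\langle f\rangle\hookrightarrow G$ is not a quasi-isometric embedding (with respect to a right-invariant Cayley metric on $\langle f\rangle$ and $d$ on $G$), and undistorted otherwise; this is independent of the choice of $d$. For non-torsion $f$, the limit $\lim_{n\to\infty} d(f^n,e)/n$ exists, and $f$ is distorted if and only if it equals $0$. A diffeomorphism $f$ is called $C^k$-distorted if it is distorted in the Polish group $\mathrm{Diff}_+^k(\mathbb{S}^1)$ or is a torsion element; otherwise it is $C^k$-undistorted. *)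

(* Defs.v *)
From HB Require Import structures.
From mathcomp Require Import all_boot all_order all_algebra.
From mathcomp Require Import all_classical all_reals all_analysis.

Set Implicit Arguments.
Unset Strict Implicit.
Unset Printing Implicit Defensive.

Import Order.TTheory GRing.Theory Num.Theory.
Import numFieldNormedType.Exports.
Import Quotient.

Local Open Scope ring_scope.
Local Open Scope classical_set_scope.

(* Groups carrying a topology.  Continuity of the group operations is not part
   of the structure: the notions below only use the group law and the topology
   separately. *)
#[short(type="topGroupType")]
HB.structure Definition TopGroup := {G of Topological G & Group G}.

Section distortion.
Variables (R : realType) (G : topGroupType).
Implicit Types (d rho : G -> G -> R) (f g h : G) (S A : set G).

Definition pseudometric d :=
  [/\ forall g h, 0 <= d g h, forall g, d g g = 0,
      forall g h, d g h = d h g &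
      forall g h k, d g k <= d g h + d h k].

Definition right_invariant d := forall g h k, d (g * k)%g (h * k)%g = d g h.

Definition cont_right_inv_pseudometric d :=
  [/\ pseudometric d, right_invariant d &
      continuous (fun gh : G * G => d gh.1 gh.2)].

Definition maximal_pseudometric d :=
  cont_right_inv_pseudometric d /\
  forall rho, cont_right_inv_pseudometric rho ->
    exists K C : R, forall g h, rho g h <= K * d g h + C.

Definition word_over S (w : seq G) :=
  forall s, s \in w -> S s \/ S (s^-1)%g.

(* Only meaningful when g lies in the subgroup generated by S. *)
Definition word_length S g : R :=
  inf [set (size w)%:R | w in
        [set w : seq G | word_over S w /\ (\prod_(s <- w) s)%g = g]].

Definition cayley_dist S g h : R := word_length S (g * h^-1)%g.

Definition quasi_isometric_embedding A (dA d : G -> G -> R) :=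
  exists K C : R, [/\ 1 <= K, 0 <= C &
    forall g h, A g -> A h ->
      K^-1 * dA g h - C <= d g h /\ d g h <= K * dA g h + C].

Definition cyclic_subgroup f : set G :=
  [set g | exists n : nat, g = (f ^+ n)%g \/ g = (f ^- n)%g].

Definition distorted_wrt d f :=
  ~ quasi_isometric_embedding (cyclic_subgroup f) (cayley_dist [set f]) d.

(* Diff_+^k(S^1) admits maximal pseudometrics, and any two of them are
   quasi-isometrically equivalent, so it does not matter which one is used. *)
Definition distorted f := forall d, maximal_pseudometric d -> distorted_wrt d f.

Definition torsion f := exists2 n : nat, (0 < n)%N & (f ^+ n)%g = 1%g.

End distortion.

(* R / Z ; [Num.int_num_subdef] is the predicate underlying [Num.int]. *)
Definition circle (R : realType) : Type :=
  Quotient.quot (GRing.ZmodClosed.clone R (@Num.int_num_subdef R) _).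

HB.instance Definition _ (R : realType) :=
  GRing.Zmodule.copy (circle R)
    (Quotient.quot (GRing.ZmodClosed.clone R (@Num.int_num_subdef R) _)).

Definition proj (R : realType) (t : R) : circle R :=
  (\pi_(Quotient.quot (GRing.ZmodClosed.clone R (@Num.int_num_subdef R) _)) t)%qT.

Definition rep (R : realType) (x : circle R) : R := (repr (x : Quotient.quot _))%qT.

Section circle_theory.
Variable R : realType.
Implicit Types (s t : R) (x y : circle R).

Lemma repK x : proj (rep x) = x.
Proof. exact: reprK. Qed.

Lemma projP s t : proj s = proj t <-> exists n : int, s = t + n%:~R.
Proof.
split=> [/eqP|[n ->]].
  rewrite -idealrBE => /Num.int_num_subproof[n nE].
  by exists n; rewrite -nE addrC subrK.
apply/eqP; rewrite -idealrBE addrC addKr.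
by apply/Num.int_num_subproof; exists n.
Qed.

Lemma projD s t : proj (s + t) = proj s + proj t.
Proof. exact: pi_add. Qed.

Lemma projN t : proj (- t) = - proj t.
Proof. exact: pi_opp. Qed.

Lemma proj0 : proj (0 : R) = 0.
Proof. by have := projD 0 0; rewrite addr0 -[LHS]addr0 => /addrI/esym. Qed.

End circle_theory.

Section circle_maps.
Variable R : realType.
Implicit Types (f g : circle R -> circle R) (F : R -> R) (k n : nat).

Definition is_lift f F := forall t, f (proj t) = proj (F t).

(* The continuous lift is unique up to an additive integer. *)
Definition circle_lift f : R -> R :=
  xget (fun t : R => t) [set F : R -> R | continuous F /\ is_lift f F].

(* The n-th derivative of f in the angular coordinate, for n >= 1. *)
Definition circle_derive n f (x : circle R) : R :=
  derive1n n (circle_lift f) (rep x).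

Definition is_Ck k F :=
  (forall j t, (j < k)%N -> derivable F^`(j) t 1) /\ continuous F^`(k).

Definition real_analytic F := forall t0, exists (a : nat -> R) (r : R),
  0 < r /\ forall t, `|t - t0| < r -> pseries a (t - t0) @ \oo --> F t.

(* An increasing lift expresses that the map preserves orientation. *)
Definition op_map (P : (R -> R) -> Prop) f :=
  exists F, [/\ is_lift f F, {homo F : s t / s < t} & P F].

Definition op_diffeo (P : (R -> R) -> Prop) f :=
  exists g, [/\ cancel f g, cancel g f, op_map P f & op_map P g].

(* The rotation number lives in R/Z. *)
Definition is_rotation_number f (rho : circle R) :=
  exists F (l : R), [/\ continuous F, is_lift f F,
    forall t, (iter n F t - t) / n%:R @[n --> \oo] --> l & rho = proj l].

End circle_maps.

Section Ck_calculus.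
Variable R : realType.
Implicit Types (F G : R -> R) (k : nat).

Lemma derivable1_continuous F : (forall t, derivable F t 1) -> continuous F.
Proof. by move=> dF t; apply: differentiable_continuous; apply/derivable1_diffP. Qed.

Lemma is_CkS k F :
  is_Ck k.+1 F <-> (forall t, derivable F t 1) /\ is_Ck k F^`().
Proof.
split=> [[dF cF]|[dF [dF' cF']]].
  split; first by move=> t; exact: (dF 0%N t).
  split; last by rewrite -derive1Sn.
  by move=> j t jk; rewrite -derive1Sn; exact: dF.
split; last by rewrite derive1Sn.
by case=> [|j] t jk; [exact: dF|rewrite derive1Sn; exact: dF'].
Qed.

Lemma is_Ck_continuous k F : is_Ck k F -> continuous F.
Proof.
case: k => [|k]; first by case.
by case/is_CkS => dF _; exact: derivable1_continuous.
Qed.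

Lemma is_CkW k F : is_Ck k.+1 F -> is_Ck k F.
Proof.
elim: k F => [|k IH] F /is_CkS[dF CF].
  by split=> //; exact: derivable1_continuous.
by apply/is_CkS; split=> //; exact: IH.
Qed.

Lemma is_CkD k F G : is_Ck k F -> is_Ck k G -> is_Ck k (fun t => F t + G t).
Proof.
elim: k F G => [|k IH] F G.
  by move=> [_ cF] [_ cG]; split=> // t; apply: cvgD; [exact: cF|exact: cG].
move=> /is_CkS[dF CF] /is_CkS[dG CG]; apply/is_CkS.
split=> [t|]; first exact: derivableD.
rewrite (_ : _^`() = fun t => derive1 F t + derive1 G t); first exact: IH.
by apply/funext => t; rewrite !derive1E deriveD.
Qed.

Lemma is_CkM k F G : is_Ck k F -> is_Ck k G -> is_Ck k (fun t => F t * G t).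
Proof.
elim: k F G => [|k IH] F G.
  by move=> [_ cF] [_ cG]; split=> // t; apply: cvgM; [exact: cF|exact: cG].
move=> CF1 CG1; have CFk := is_CkW CF1; have CGk := is_CkW CG1.
move: CF1 CG1 => /is_CkS[dF CF] /is_CkS[dG CG]; apply/is_CkS.
split=> [t|]; first exact: derivableM.
rewrite (_ : _^`() = fun t => F t * derive1 G t + G t * derive1 F t).
  by apply: is_CkD; exact: IH.
by apply/funext => t; rewrite !derive1E deriveM.
Qed.

Lemma is_Ck_comp k F G : is_Ck k F -> is_Ck k G -> is_Ck k (F \o G).
Proof.
elim: k F G => [|k IH] F G.
  move=> [_ cF] [_ cG]; split=> // t.
  by apply: continuous_comp; [exact: cG|exact: cF].
move=> CF1 CG1; have CGk := is_CkW CG1.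
move: CF1 CG1 => /is_CkS[dF CF] /is_CkS[dG CG]; apply/is_CkS.
split=> [t|].
  apply/derivable1_diffP; apply: differentiable_comp;
  exact/derivable1_diffP.
rewrite (_ : _^`() = fun t => (derive1 F \o G) t * derive1 G t).
  by apply: is_CkM => //; exact: IH.
by apply/funext => t; rewrite derive1_comp.
Qed.

Lemma is_Ck_cst k (c : R) : is_Ck k (fun=> c).
Proof.
elim: k c => [|k IH] c; first by split=> // t; exact: cst_continuous.
apply/is_CkS; split=> [t|]; first exact: derivable_cst.
rewrite (_ : _^`() = fun _ : R => (0 : R)); first exact: IH.
by apply/funext => t; rewrite derive1_cst.
Qed.

Lemma is_Ck_id k : is_Ck k (@id R).
Proof.
case: k => [|k]; first by split=> // t; exact: cvg_id.
apply/is_CkS; split=> [t|]; first exact: derivable_id.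
rewrite (_ : _^`() = fun _ : R => (1 : R)); first exact: is_Ck_cst.
by apply/funext => t; rewrite derive1_id.
Qed.

End Ck_calculus.

Section Diff.
Variables (R : realType) (k : nat).

(* The group Diff_+^k of the circle (homeomorphisms for k = 0). *)
Record Diff := MkDiff {
  diff_fun :> circle R -> circle R;
  diff_op_diffeo : op_diffeo (@is_Ck R k) diff_fun }.

Lemma diff_inj (f g : Diff) : f =1 g -> f = g.
Proof.
case: f g => [f pf] [g pg] /funext /= fg; case: g / fg pg => pg.
by congr MkDiff; exact: Prop_irrelevance.
Qed.

Lemma op_map_comp (f g : circle R -> circle R) :
  op_map (@is_Ck R k) f -> op_map (@is_Ck R k) g ->
  op_map (@is_Ck R k) (f \o g).
Proof.
move=> [F [lF iF CF]] [G [lG iG CG]]; exists (F \o G); split.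
- by move=> t /=; rewrite lG lF.
- by move=> s t st /=; apply/iF/iG.
- exact: is_Ck_comp.
Qed.

Lemma op_diffeo_id : op_diffeo (@is_Ck R k) id.
Proof.
have id_map : op_map (@is_Ck R k) id.
  by exists id; split=> //; exact: is_Ck_id.
by exists id; split.
Qed.

Lemma op_diffeo_comp (f g : circle R -> circle R) :
  op_diffeo (@is_Ck R k) f -> op_diffeo (@is_Ck R k) g ->
  op_diffeo (@is_Ck R k) (f \o g).
Proof.
move=> [f' [fK f'K Cf Cf']] [g' [gK g'K Cg Cg']]; exists (g' \o f'); split.
- exact: can_comp.
- exact: can_comp.
- exact: op_map_comp.
- exact: op_map_comp.
Qed.

Definition diff_one := MkDiff op_diffeo_id.

Definition diff_mul (f g : Diff) :=
  MkDiff (op_diffeo_comp (diff_op_diffeo f) (diff_op_diffeo g)).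

Lemma diff_inv_subproof (f : Diff) :
  {g : Diff | cancel f g /\ cancel g f}.
Proof.
apply: cid; case: f => f [g [fK gK Cf Cg]] /=.
have gP : op_diffeo (@is_Ck R k) g by exists f; split.
by exists (MkDiff gP).
Qed.

Definition diff_inv (f : Diff) : Diff := sval (diff_inv_subproof f).

Lemma diff_mulA : associative diff_mul.
Proof. by move=> f g h; exact: diff_inj. Qed.

Lemma diff_mul1g : left_id diff_one diff_mul.
Proof. by move=> f; exact: diff_inj. Qed.

Lemma diff_mulg1 : right_id diff_one diff_mul.
Proof. by move=> f; exact: diff_inj. Qed.

Lemma diff_mulVg : left_inverse diff_one diff_inv diff_mul.
Proof.
move=> f; apply: diff_inj => x.
by have [fK _] := svalP (diff_inv_subproof f); exact: fK.
Qed.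

Lemma diff_mulgV : right_inverse diff_one diff_inv diff_mul.
Proof.
move=> f; apply: diff_inj => x.
by have [_ fK] := svalP (diff_inv_subproof f); exact: fK.
Qed.

HB.instance Definition _ := gen_eqMixin Diff.
HB.instance Definition _ := gen_choiceMixin Diff.
HB.instance Definition _ := isGroup.Build Diff
  diff_mulA diff_mul1g diff_mulg1 diff_mulVg diff_mulgV.

(* Balls of the uniform C^k topology; the first clause bounds the distance of
   f x and g x in R/Z. *)
Definition diff_ball (f : Diff) (e : R) (g : Diff) : Prop :=
  (forall x, exists2 t : R, `|t| < e & g x - f x = proj t) /\
  (forall j x, (0 < j <= k)%N ->
     `|circle_derive j f x - circle_derive j g x| < e).

Lemma diff_ball_center f (e : R) : 0 < e -> diff_ball f e f.
Proof.
move=> e0; split=> [x|j x _]; last by rewrite subrr normr0.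
by exists 0; rewrite ?normr0// subrr proj0.
Qed.

Lemma diff_ball_sym f g (e : R) : diff_ball f e g -> diff_ball g e f.
Proof.
move=> [fg dfg]; split=> [x|j x jk]; last by rewrite distrC dfg.
have [t te fgE] := fg x; exists (- t); first by rewrite normrN.
by rewrite projN -fgE opprB.
Qed.

Lemma diff_ball_triangle f g h (e1 e2 : R) :
  diff_ball f e1 g -> diff_ball g e2 h -> diff_ball f (e1 + e2) h.
Proof.
move=> [fg dfg] [gh dgh]; split=> [x|j x jk].
  have [s se fgE] := fg x; have [t te ghE] := gh x.
  exists (s + t); first by rewrite (le_lt_trans (ler_normD _ _))// ltrD.
  by rewrite projD -fgE -ghE [RHS]addrC subrKA.
rewrite (le_lt_trans (ler_distD (circle_derive j g x) _ _))//.
by rewrite ltrD ?dfg ?dgh.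
Qed.

HB.instance Definition _ := hasNbhs.Build Diff (nbhs_ (entourage_ diff_ball)).
HB.instance Definition _ := Nbhs_isPseudoMetric.Build R Diff
  erefl diff_ball_center diff_ball_sym diff_ball_triangle erefl.

End Diff.

Definition Ck_distorted (R : realType) (k : nat) (f : circle R -> circle R) :=
  exists2 g : Diff R k, g = f :> (circle R -> circle R) &
    distorted R g \/ torsion g.

Section circle_derive_theory.
Variable R : realType.
Implicit Types (f : circle R -> circle R) (F G : R -> R).

Lemma continuous_int_cst (H : R -> R) : continuous H ->
  (forall t, H t \is a Num.int) -> forall t, H t = H 0.
Proof.
move=> cH zH.
have step s t : s <= t -> H s = H t.
  move=> st; apply/eqP/negPn/negP => Hst.
  pose m := Num.min (H s) (H t).
  have mz : m \is a Num.int by rewrite /m minEle; case: (_ <= _).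
  have mv : m + 2^-1 <= Num.max (H s) (H t).
    have : 1 <= Num.max (H s) (H t) - m.
      have d0 : 0 < Num.max (H s) (H t) - m.
        by move: Hst; rewrite subr_gt0 neq_lt => /orP[] h; rewrite /m gt_min !lt_max h ?orbT.
      have dz : Num.max (H s) (H t) - m \is a Num.int.
        by rewrite rpredB// maxEle; case: (_ <= _).
      by have := norm_intr_ge1 dz (lt0r_neq0 d0); rewrite gtr0_norm.
    have h2 : (2^-1 : R) <= 1 by rewrite invf_le1// ler1n.
    by move=> h1; rewrite -lerBrDl (le_trans h2).
  have cst : {within `[s, t], continuous H} by exact: continuous_subspaceT.
  have mle : m <= m + 2^-1 by rewrite lerDl invr_ge0.
  have [c _ Hc] := @IVT R H s t (m + 2^-1) st cst
    (introT andP (conj mle mv)).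
  have : (2^-1 : R) \is a Num.int.
    by have := rpredB (zH c) mz; rewrite Hc addrC addKr.
  move=> z2; have := norm_intr_ge1 z2.
  rewrite gtr0_norm ?invr_gt0// invr_eq0 pnatr_eq0 => /(_ isT).
  by rewrite leNgt invf_lt1 ?ltr1n.
move=> t; have [t0|t0] := leP 0 t; first by rewrite (step 0 t).
by rewrite (step t 0)// ltW.
Qed.

Lemma is_lift_unique f F G : continuous F -> continuous G ->
  is_lift f F -> is_lift f G -> exists c, F = fun t => G t + c.
Proof.
move=> cF cG lF lG; exists (F 0 - G 0).
have cH : continuous (fun t : R => F t - G t).
  by move=> t; apply: cvgB; [exact: cF|exact: cG].
have zH t : F t - G t \is a Num.int.
  have [|n FG] := (projP (F t) (G t)).1; first by rewrite -lF -lG.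
  rewrite FG addrC addKr; exact: intr_int.
apply/funext => t; rewrite -(continuous_int_cst cH zH t).
by rewrite addrC subrK.
Qed.

Lemma derive1n_addc F c n : (0 < n)%N ->
  derive1n n (fun t => F t + c) = derive1n n F.
Proof.
case: n => // n _; rewrite !derive1Sn; congr derive1n.
apply/funext => t; rewrite /derive1; apply: (congr1 (fun u : R -> R => lim (u @ (0:R)^'))).
by apply/funext => h /=; rewrite opprD addrACA subrr addr0.
Qed.

Lemma derive1n_shift F c n t :
  derive1n n (fun s => F (s + c)) t = derive1n n F (t + c).
Proof.
suff -> : derive1n n (fun s => F (s + c)) = fun s => derive1n n F (s + c) by [].
elim: n => [//|n IH]; rewrite !derive1nS IH; apply/funext => s.
rewrite /derive1; apply: (congr1 (fun u : R -> R => lim (u @ (0:R)^'))).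
by apply/funext => h /=; rewrite addrA.
Qed.

Lemma circle_deriveE f F n t : continuous F -> is_lift f F -> (0 < n)%N ->
  circle_derive n f (proj t) = derive1n n F t.
Proof.
move=> cF lF n0; rewrite /circle_derive.
have [cL lL] : continuous (circle_lift f) /\ is_lift f (circle_lift f).
  by apply: (@xgetPex _ (fun t : R => t)
    [set F : R -> R | continuous F /\ is_lift f F]); exists F.
have [c ->] := is_lift_unique cL cF lL lF; rewrite derive1n_addc//.
have [|m ->] := (projP (rep (proj t)) t).1; first by rewrite repK.
rewrite -derive1n_shift.
have cS : continuous (fun s : R => F (s + m%:~R)).
  move=> s; apply: continuous_comp; last exact: cF.
  by apply: cvgD; [exact: cvg_id|exact: cvg_cst].
have lS : is_lift f (fun s => F (s + m%:~R)).
  by move=> s; rewrite -lF; congr f; apply/projP; exists (- m); rewrite mulrNz addrK.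
by have [d ->] := is_lift_unique cS cF lS lF; rewrite derive1n_addc.
Qed.

End circle_derive_theory.

(* Main.v *)
(* In the coordinate x = cot (pi t) the affine maps x |-> a x + b act on the
   circle fixing t = 0 (x = oo).  Let f be x |-> x + 1 and m be x |-> 2 x.  Then
   m f = f^2 m, so f^(2^n) is the conjugate of f by m^n and its distance to the
   identity grows at most linearly in n: f is distorted in every Diff^k.  The only
   fixed point of f is oo, where it is parabolic.
   The lift F of x |-> a x + b satisfies F' = a / q with q a positive
   trigonometric polynomial; the Taylor coefficients of q are bounded by C K^n
   uniformly in the base point, hence so are those of 1 / q and of F. *)
Require Import Defs.
From HB Require Import structures.
From mathcomp Require Import all_boot all_order all_algebra.
From mathcomp Require Import all_classical all_reals all_analysis.
From mathcomp Require Import ring lra.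

Set Implicit Arguments.
Unset Strict Implicit.
Unset Printing Implicit Defensive.

Import Order.TTheory GRing.Theory Num.Theory.
Import numFieldNormedType.Exports.

Local Open Scope ring_scope.
Local Open Scope classical_set_scope.

(** * Distortion from a doubling relation in a topological group *)

Section distortion_by_conjugation.
Variables (R : realType) (G : topGroupType).
Implicit Types (d : G -> G -> R) (g h u m : G).

(** By right invariance [d (g * h) h = d g 1], so the triangle inequality through [h] suffices. *)
Lemma pseudonormM d g h : pseudometric d -> right_invariant d ->
  d (g * h)%g 1%g <= d g 1%g + d h 1%g.
Proof.
move=> [_ _ _ tri] inv.
by rewrite (le_trans (tri _ h _))// lerD2r -{2}(mul1g h) inv.
Qed.

Lemma pseudonormV d g : pseudometric d -> right_invariant d ->
  d (g^-1)%g 1%g = d g 1%g.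
Proof. by move=> [_ _ sym _] inv; rewrite -(inv _ _ g) mulVg mul1g sym. Qed.

Lemma pseudonormX d g n : pseudometric d -> right_invariant d ->
  d (g ^+ n)%g 1%g <= n%:R * d g 1%g.
Proof.
move=> pd inv; elim: n => [|n IH].
  by case: pd => _ d0 _ _; rewrite expg0 d0 mul0r.
rewrite expgS (le_trans (pseudonormM _ _ pd inv))//.
by rewrite -natr1 mulrDl mul1r addrC lerD2r.
Qed.

(** [i] counts the letters [u] and [j] the inverse letters; keeping [u ^+ j] on the left avoids
    integer exponents. *)
Lemma word_over1_expg u w : word_over [set u] w ->
  exists i j, (i + j)%N = size w /\ ((\prod_(s <- w) s) * u ^+ j = u ^+ i)%g.
Proof.
elim: w => [|s w IH] ws.
  by exists 0%N, 0%N; rewrite big_nil mulg1.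
have [|i [j [ijE wE]]] := IH.
  by move=> x xw; apply: ws; rewrite inE xw orbT.
have [->|sE] := ws s (mem_head _ _); [exists i.+1, j|exists i, j.+1].
  by rewrite big_cons -mulgA wE -expgS addSn ijE.
rewrite big_cons addnS ijE; split=> //.
by rewrite -[s]invgK sE expgSr !mulgA -(mulgA _ _ (u ^+ j)%g) wE -mulgA -expgSr expgS mulKg.
Qed.

Lemma non_torsion_expg_inj u : ~ torsion u ->
  injective (fun n => u ^+ n)%g.
Proof.
move=> ntu i j; wlog: i j / (i <= j)%N => [wl ij|le_ij].
  by have [?|/ltnW ?] := leqP i j; [exact: wl|apply/esym/wl].
rewrite /= -(subnK le_ij) expgnDr -{1}[(u ^+ i)%g]mul1g => /mulIg/esym e1.
case: (posnP (j - i)) => [->//|ji0].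
by case: ntu; exists (j - i)%N.
Qed.

Lemma word_length_expg u n : ~ torsion u ->
  n%:R <= word_length R [set u] (u ^+ n)%g.
Proof.
move=> ntu; apply: lb_le_inf.
  exists (size (nseq n u))%:R, (nseq n u) => //=; split.
    by move=> s; rewrite mem_nseq => /andP[_ /eqP]; left.
  by rewrite big_nseq; elim: n => //= n ->; rewrite expgS.
move=> _ [w [/word_over1_expg[i [j [<- wE]]] wu] <-].
rewrite ler_nat; move: wE; rewrite wu -expgnDr.
(* Injectivity gives [i = n + j], so the length [i + j] is at least [n]. *)
by move=> /(non_torsion_expg_inj ntu) <-; rewrite -addnA leq_addr.
Qed.

Lemma expg_pow2_conj u m n : (m * u = u ^+ 2 * m)%g ->
  (u ^+ (2 ^ n) = m ^+ n * u * (m ^+ n)^-1)%g.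
Proof.
move=> mu; have muX k : (m * u ^+ k = u ^+ (2 * k) * m)%g.
  elim: k => [|k IH]; first by rewrite mulg1 mul1g.
  by rewrite expgSr mulgA IH -mulgA mu mulgA -expgnDr -mulnSr.
suff -> : (m ^+ n * u = u ^+ (2 ^ n) * m ^+ n)%g by rewrite mulgK.
elim: n => [|n IH]; first by rewrite mulg1 mul1g.
by rewrite expgS -mulgA IH mulgA muX expnS mulgA.
Qed.

(* The exponents 2^n grow exponentially, whereas u^(2^n), a conjugate of u by
   m^n, has linearly bounded distance to the identity. *)
Lemma distorted_of_doubling u m : (m * u = u ^+ 2 * m)%g ->
  distorted R u \/ torsion u.
Proof.
move=> mu; have [tu|ntu] := pselect (torsion u); [by right|left].
move=> d [[pd inv _] _] [K [C [K1 C0 QI]]].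
have K0 : 0 < K by exact: lt_le_trans K1.
have Nge0 g : 0 <= d g 1%g by case: pd.
set A := d m 1%g; set B := d u 1%g.
have key n : (2 ^ n)%:R <= K * (n%:R * (2 * A) + (B + C)).
  have [||QI1 _] := QI (u ^+ (2 ^ n))%g 1%g.
  - by exists (2 ^ n)%N; left.
  - by exists 0%N; left; rewrite expg0.
  rewrite /cayley_dist invg1 mulg1 lerBlDr in QI1.
  rewrite -ler_pdivrMl//.
  have h1 : K^-1 * (2 ^ n)%:R <= K^-1 * word_length R [set u] (u ^+ (2 ^ n))%g.
    by rewrite ler_pM2l ?invr_gt0//; exact: word_length_expg.
  apply: (le_trans h1); apply: (le_trans QI1).
  rewrite addrA lerD2r (expg_pow2_conj _ mu).
  apply: le_trans (pseudonormM _ _ pd inv) _.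
  rewrite (pseudonormV _ pd inv).
  have h2 := pseudonormM (m ^+ n)%g u pd inv.
  have h3 := pseudonormX m n pd inv.
  rewrite -/A -/B in h2 h3 *; lra.
(* At exponent [2 * p] the linear bound is at most [D * (p + 1)], while [2 ^ (2 * p) >= (p + 1) ^ 2]
   exceeds this because [p > D]. *)
pose D := K * (4 * A + (B + C)).
pose p := Num.bound D.
have A0 : 0 <= A by exact: Nge0.
have B0 : 0 <= B by exact: Nge0.
have D0 : 0 <= D by apply: mulr_ge0; [exact: ltW|lra].
have pD : D < p%:R by have := archi_boundP D0.
have := key (2 * p)%N; rewrite mulnC expnM natrX.
have p2 : p%:R + 1 <= (2 ^ p)%:R :> R by rewrite natr1 ler_nat ltn_expl.
have p0 : 0 <= p%:R :> R by [].
have h4 : D * (p%:R + 1) < (p%:R + 1) * (p%:R + 1).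
  by rewrite ltr_pM2r; lra.
have h5 : (p%:R + 1) * (p%:R + 1) <= (2 ^ p)%:R ^+ 2 :> R.
  by rewrite expr2 ler_pM//; lra.
have h6 : K * ((p * 2)%:R * (2 * A) + (B + C)) <= D * (p%:R + 1).
  rewrite /D -mulrA ler_pM2l// natrM.
  have : 0 <= p%:R * (B + C) by rewrite mulr_ge0//; lra.
  lra.
by move=> h7; have := lt_le_trans h4 (le_trans h5 (le_trans h7 h6)); rewrite ltxx.
Qed.

End distortion_by_conjugation.

(** * Taylor coefficients as functions of the base point *)

Section taylor_towers.
Variable R : realType.
Implicit Types (u v : nat -> R -> R) (F f q : R -> R) (n k : nat) (s t : R).

(* u n stands for the n-th Taylor coefficient of u 0, as a function of the base
   point. *)
Definition taylor_tower u :=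
  forall n t, is_derive t (1 : R) (u n) (n.+1%:R * u n.+1 t).

(** Uniform in [t], because the mean value form of the remainder involves a coefficient at an
    unknown point. *)
Definition geometrically_bounded u :=
  exists C K, [/\ 0 <= C, 0 < K & forall n t, `|u n t| <= C * K ^+ n].

(** Differentiating the Taylor sum in its base point telescopes and leaves only the last term. For
    [n = 0] the factor [n%:R] makes the truncated [n.-1] harmless. *)
Lemma is_derive_taylor_sum u n s t : taylor_tower u ->
  is_derive s (1 : R) (fun x => \sum_(i < n) u i x * (t - x) ^+ i)
    (n%:R * u n s * (t - s) ^+ n.-1).
Proof.
move=> tu; elim: n => [|n IH].
  rewrite !mul0r (_ : (fun _ => _) = cst 0); first exact: is_derive_cst.
  by apply/funext => x; rewrite big_ord0.
rewrite (_ : (fun _ => _) = (fun x => \sum_(i < n) u i x * (t - x) ^+ i) +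
    u n * (cst t - id) ^+ n); last first.
  by apply/funext => x; rewrite big_ord_recr /= !fctE.
have db := is_deriveX n (is_deriveB (is_derive_cst t s 1) (is_derive_id s (1 : R))).
apply: is_derive_eq (is_deriveD IH (is_deriveM (tu n s) db)) _.
rewrite !fctE /GRing.scale /=.
by ring.
Qed.

(** Covers both orders of [s] and [t]; the remainder estimate uses only the distance from [c] to
    [t]. *)
Lemma MVT_norm f f' s t : (forall x, is_derive x (1 : R) f (f' x)) ->
  exists2 c, `|t - c| <= `|t - s| & f t - f s = f' c * (t - s).
Proof.
move=> df; have cf a b : {within `[a, b], continuous f}.
  apply: continuous_subspaceT; apply: derivable1_continuous => x.
  by have := df x; case.
have [st|/ltW ts] := leP s t.
  have [c] := MVT_segment st (fun x _ => df x) (@cf _ _).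
  rewrite in_itv/= => /andP[sc ct] fE; exists c => //.
  by rewrite !ger0_norm ?subr_ge0// lerD2l lerN2.
have [c] := MVT_segment ts (fun x _ => df x) (@cf _ _).
rewrite in_itv/= => /andP[tc cs] fE; exists c.
  by rewrite !ler0_norm ?subr_le0// !opprB lerD2r.
by rewrite -opprB fE -mulrN opprB.
Qed.

(** The mean value theorem in the base point, between [t0] and [t], yields the Taylor remainder.
    Bounds start at index 1, since the lift taken as [u 0] is unbounded. *)
Lemma taylor_tower_analytic u (C K : R) : taylor_tower u -> 0 <= C -> 0 < K ->
  (forall n t, `|u n.+1 t| <= C * K ^+ n.+1) -> real_analytic (u 0%N).
Proof.
move=> tu C0 K0 ub t0; exists (u ^~ t0), (4 * K)^-1.
have K4 : 0 < 4 * K by rewrite mulr_gt0.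
split=> [|t tt0]; first by rewrite invr_gt0.
have Ktt : K * `|t - t0| <= 4^-1.
  by rewrite -ler_pdivlMl// mulrC -invfM ltW// mulrC.
(* As [K * |t - t0| <= 1/4], the remainder is at most [C * (n + 1) / 4 ^ (n + 1)], and
   [n + 1 <= 2 ^ (n + 1)]. *)
have bound n : `|u 0%N t - pseries (u ^~ t0) (t - t0) n.+1| <= C * 2^-1 ^+ n.+1.
  rewrite /pseries /series /= big_mkord.
  have -> : u 0%N t = \sum_(i < n.+1) u i t * (t - t) ^+ i.
    rewrite big_ord_recl expr0 mulr1 big1 ?addr0// => i _.
    by rewrite subrr expr0n mulr0.
  have [c ct ->] := MVT_norm t0 t (fun x => is_derive_taylor_sum n.+1 x t tu).
  rewrite !normrM normrX normr_nat.
  have le1 : n.+1%:R * `|u n.+1 c| * `|t - c| ^+ n * `|t - t0| <=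
      C * (n.+1%:R * (K * `|t - t0|) ^+ n.+1).
    rewrite (_ : C * _ = n.+1%:R * (C * K ^+ n.+1) * `|t - t0| ^+ n * `|t - t0|).
      by rewrite ler_wpM2r// ler_pM// ?ler_wpM2l// ?mulr_ge0// lerXn2r ?nnegrE.
    by rewrite exprMn !exprS; ring.
  apply: (le_trans le1); rewrite ler_wpM2l// (_ : 2^-1 ^+ n.+1 = 2 ^+ n.+1 * 4^-1 ^+ n.+1).
    rewrite ler_pM ?exprn_ge0 ?mulr_ge0 ?(ltW K0)//.
      by rewrite -natrX ler_nat ltnW// ltn_expl.
    by rewrite lerXn2r ?nnegrE ?mulr_ge0 ?(ltW K0)// invr_ge0.
  by rewrite -exprMn; congr (_ ^+ _); field.
rewrite -cvg_shiftS.
have half0 : C * 2^-1 ^+ n.+1 @[n --> \oo] --> 0.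
  rewrite -[X in _ --> X](mulr0 C); apply: cvgMr; rewrite cvg_shiftS.
  by apply: cvg_expr; rewrite ger0_norm ?invr_ge0// invf_lt1 ?ltr1n.
apply/cvgrPdist_le => e e0.
have := half0; move/cvgrPdist_le => /(_ e e0); apply: filterS => n.
rewrite sub0r normrN; apply: le_trans; apply: le_trans (bound n) _.
exact: ler_norm.
Qed.

(** * Inverses, products and trigonometric polynomials *)

Lemma is_Ck_inv k q : (forall t, q t != 0) -> is_Ck k q ->
  is_Ck k (fun t => (q t)^-1).
Proof.
move=> q0; elim: k => [|k IH] Cq.
  by split=> // t; apply: cvgV; [exact: q0|exact: (is_Ck_continuous Cq)].
have Cqk := IH (is_CkW Cq); move/is_CkS : Cq => [dq Cq]; apply/is_CkS.
split=> [t|]; first exact: derivableV.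
rewrite (_ : _^`() = fun t => -1 * ((q t)^-1 * (q t)^-1 * derive1 q t)).
  by apply: is_CkM; [exact: is_Ck_cst|apply: is_CkM => //; exact: is_CkM].
apply/funext => t; rewrite !derive1E deriveV// /GRing.scale /=.
by rewrite expr2 invfM; ring.
Qed.

Lemma smooth_taylor_tower f : (forall k, is_Ck k f) ->
  taylor_tower (fun n t => derive1n n f t / n`!%:R).
Proof.
move=> Cf n t; have dfn := derivableP ((Cf n.+1).1 n t (ltnSn n)).
rewrite (_ : (fun _ => _) = n`!%:R^-1 *: derive1n n f).
  apply: is_derive_eq; rewrite derive1nS derive1E /GRing.scale /= factS natrM.
  by rewrite invfM mulrCA mulVKf// mulrC.
by apply/funext => x; rewrite mulrC.
Qed.

Lemma taylor_tower_mul u v : taylor_tower u -> taylor_tower v ->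
  taylor_tower (fun n t => \sum_(i < n.+1) u i t * v (n - i)%N t).
Proof.
move=> tu tv n t.
rewrite (_ : (fun _ => _) = \sum_(i < n.+1) (u i * v (n - i)%N)); last first.
  by apply/funext => x; rewrite fct_sumE.
have duv (i : 'I_n.+1) : is_derive t (1 : R) (u i * v (n - i)%N)
    (i.+1%:R * u i.+1 t * v (n - i)%N t +
     (n.+1 - i)%:R * u i t * v (n.+1 - i)%N t).
  have := tu i t; have := tv (n - i)%N t => ? ?.
  apply: is_derive_eq; rewrite /GRing.scale /= (subSn (ltnSE (ltn_ord i))).
  by ring.
apply: is_derive_eq; rewrite big_split/=.
(* Splitting [n + 1 = i + (n + 1 - i)], with zero terms at [i = 0] and [i = n + 1], matches the two
   halves of the product rule. *)
rewrite (_ : n.+1%:R * _ = \sum_(i < n.+2) i%:R * u i t * v (n.+1 - i)%N t +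
  \sum_(i < n.+2) (n.+1 - i)%:R * u i t * v (n.+1 - i)%N t); last first.
  rewrite mulr_sumr -big_split; apply: eq_bigr => i _ /=.
  rewrite natrB; last exact: ltn_ord i.
  by ring.
congr (_ + _); first by rewrite [RHS]big_ord_recl !mul0r add0r.
by rewrite [RHS]big_ord_recr /= subnn !mul0r addr0.
Qed.

Lemma taylor_tower_cst u (c : R) n t :
  taylor_tower u -> (forall x, u 0%N x = c) -> u n.+1 t = 0.
Proof.
move=> tu u0; suff cu m : exists d, u m = cst d.
  have [d un] := cu n; have := tu n t.
  rewrite un => du; have := @derive_val _ _ _ _ _ _ _ du.
  by rewrite derive_cst => /esym/eqP; rewrite mulf_eq0 pnatr_eq0 /= => /eqP.
elim: m => [|m [d um]]; first by exists c; apply/funext => x; rewrite u0.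
exists 0; apply/funext => x; have := tu m x; rewrite um => du.
have := @derive_val _ _ _ _ _ _ _ du; rewrite derive_cst => /esym/eqP.
by rewrite mulf_eq0 pnatr_eq0 /= => /eqP.
Qed.

Lemma taylor_tower_Ck u n k : taylor_tower u -> is_Ck k (u n).
Proof.
move=> tu; elim: k n => [|k IH] n.
  split=> //; apply: derivable1_continuous => t.
  by have [] := tu n t.
apply/is_CkS; split=> [t|]; first by have [] := tu n t.
rewrite (_ : _^`() = fun t => n.+1%:R * u n.+1 t).
  by apply: is_CkM; [exact: is_Ck_cst|exact: IH].
by apply/funext => t; rewrite derive1E; have := tu n t => ?; rewrite derive_val.
Qed.

(* The Taylor coefficients of the inverse satisfy the recursion of formal power
   series inversion, because those of the product with u are 1, 0, 0, ... *)
Lemma taylor_tower_inv u (M : R) : taylor_tower u -> geometrically_bounded u ->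
  (forall t, u 0%N t != 0) -> (forall t, `|(u 0%N t)^-1| <= M) ->
  exists v, [/\ taylor_tower v, geometrically_bounded v &
    v 0%N = fun t => (u 0%N t)^-1].
Proof.
move=> tu [C [K [C0 K0 uCK]]] u0 uM.
have M0 : 0 <= M by exact: le_trans (uM 0).
have Cv k : is_Ck k (fun t => (u 0%N t)^-1).
  by apply: is_Ck_inv => //; exact: taylor_tower_Ck.
have := smooth_taylor_tower Cv; set v := (v in taylor_tower v) => tv.
have v0 : v 0%N = fun t => (u 0%N t)^-1.
  by apply/funext => t; rewrite /v /= divr1.
exists v; split=> //.
have vS n t : v n.+1 t = - v 0%N t * \sum_(i < n.+1) u i.+1 t * v (n - i)%N t.
  have := taylor_tower_cst n t (taylor_tower_mul tu tv) (c := 1).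
  rewrite big_ord_recl subn0 => /(_ _)/eqP.
  rewrite addr_eq0 => e; rewrite mulNr -mulrN (_ : - _ = u 0%N t * v n.+1 t).
    by rewrite mulrA v0 mulVf ?mul1r.
  apply/esym/eqP; rewrite (eqP (e _)) // => x.
  by rewrite big_ord1 v0 /= mulfV.
have vM t : `|v 0%N t| <= M by rewrite v0.
(* [L - K = M * C * K] makes the geometric sum of the recursion collapse to
   [L ^ (n + 1) - K ^ (n + 1)]. *)
pose L := K + M * C * K.
have KL : K <= L by rewrite lerDl !mulr_ge0// ltW.
have L0 : 0 < L by exact: lt_le_trans KL.
exists M, L; split=> // n; elim/ltn_ind: n => -[|n] IH t.
  by rewrite expr0 mulr1.
rewrite vS normrM normrN.
have geo : M * C * K * \sum_(i < n.+1) K ^+ i * L ^+ (n - i) <= L ^+ n.+1.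
  have := subrXX L K n.+1; rewrite /= => e.
  rewrite (_ : M * C * K = L - K); last by rewrite /L addrC addKr.
  rewrite (_ : \sum_(i < n.+1) K ^+ i * L ^+ (n - i) =
     \sum_(i < n.+1) L ^+ (n - i) * K ^+ i).
    by rewrite -e gerBl exprn_ge0// ltW.
  by apply: eq_bigr => i _; rewrite mulrC.
apply: le_trans (ler_wpM2l M0 geo).
rewrite ler_pM//; apply: le_trans (ler_norm_sum _ _ _) _.
rewrite mulr_sumr; apply: ler_sum => i _; rewrite normrM.
apply: le_trans (ler_pM _ _ (uCK _ _) (IH (n - i)%N _ t)) _ => //.
  by rewrite ltnS leq_subr.
by rewrite exprS le_eqVlt; apply/orP; left; apply/eqP; ring.
Qed.

(** Each derivative shifts the phase by [pi / 2] and contributes a factor [2 * pi]; the constant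
    [al] enters in degree 0 only. *)
Lemma taylor_tower_trig (al be ga : R) : exists u,
  [/\ taylor_tower u, geometrically_bounded u &
    u 0%N = fun t => al + be * cos (2 * pi * t) + ga * sin (2 * pi * t)].
Proof.
pose ph n t : R := 2 * pi * t + n%:R * (pi / 2).
pose u n t := (if n is 0%N then al else 0) +
  (2 * pi) ^+ n / n`!%:R * (be * cos (ph n t) + ga * sin (ph n t)).
exists u; split.
- move=> n t.
  have dph : is_derive t (1 : R) (ph n) (2 * pi).
    by apply: is_derive_eq; rewrite /GRing.scale/=; ring.
  have dcos := is_derive1_comp (is_derive_cos (ph n t)) dph.
  have dsin := is_derive1_comp (is_derive_sin (ph n t)) dph.
  have du := is_deriveD (is_derive_cst (if n is 0%N then al else 0) t 1)
    (is_deriveZ ((2 * pi) ^+ n / n`!%:R)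
      (is_deriveD (is_deriveZ be dcos) (is_deriveZ ga dsin))).
  apply: is_derive_eq du _; rewrite /GRing.scale/= /u add0r add0r.
  have -> : ph n.+1 t = ph n t + pi / 2 by rewrite /ph -natr1; ring.
  rewrite cosDpihalf sinDpihalf factS natrM invfM exprS.
  have : n.+1%:R != 0 :> R by [].
  by move: n.+1%:R (n`!%:R^-1) => N I N0; field.
- exists (`|al| + `|be| + `|ga|), (2 * pi); split.
  + by rewrite !addr_ge0.
  + by rewrite mulr_gt0 ?pi_gt0.
  move=> n t; have pi2 : 0 <= 2 * pi :> R by rewrite mulr_ge0// pi_ge0.
  have nrmM (x y : R) : `|y| <= 1 -> `|x * y| <= `|x|.
    by move=> y1; rewrite normrM ler_piMr.
  have trig : `|be * cos (ph n t) + ga * sin (ph n t)| <= `|be| + `|ga|.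
    rewrite (le_trans (ler_normD _ _))// lerD// nrmM// ler_norml.
      by rewrite cos_geN1 cos_le1.
    by rewrite sin_geN1 sin_le1.
  rewrite -addrA mulrDl (le_trans (ler_normD _ _))// lerD//.
    case: n {trig} => [|n]; first by rewrite expr0 mulr1.
    by rewrite normr0 mulr_ge0// exprn_ge0.
  rewrite normrM mulrC ler_pM// normrM normfV normrX (ger0_norm pi2).
  by rewrite ler_piMr ?exprn_ge0// invf_le1 normr_nat ?ler1n ?ltr0n fact_gt0.
by apply/funext => t; rewrite /u /ph mul0r addr0 expr0 fact0 divr1 mul1r addrA.
Qed.

(** The tower of [F] is that of [c * v] moved up one degree and divided by the degree; the [1 / K]
    in the constant makes up for the shift. *)
Lemma real_analytic_primitive F v (c : R) :
  (forall t, is_derive t (1 : R) F (c * v 0%N t)) ->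
  taylor_tower v -> geometrically_bounded v ->
  real_analytic F /\ forall k, is_Ck k F.
Proof.
move=> dF tv [C [K [C0 K0 vCK]]].
pose u n := if n is m.+1 then (c / m.+1%:R) *: v m else F.
have tu : taylor_tower u.
  case=> [|n] t.
    apply: is_derive_eq (dF t) _; rewrite /u /=.
    by rewrite divr1 mul1r.
  have dv := tv n t; apply: is_derive_eq; rewrite /GRing.scale/= /u.
  rewrite /GRing.scale /= /GRing.scale /= -!mulrA mulKf//.
  by rewrite [RHS]mulrCA mulVKf.
split=> [|k]; last exact: (taylor_tower_Ck 0 k tu).
apply: (@taylor_tower_analytic u (`|c| * C / K) K) => //.
  by rewrite !mulr_ge0// ltW// invr_gt0.
move=> n t; rewrite /u /= normrM normrM.
rewrite exprS mulrA mulfVK ?gt_eqF//.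
rewrite -(mulrA `|c|) -(mulrA `|c| C) ler_wpM2l//.
rewrite -[leRHS]mul1r ler_pM// normfV normr_nat invf_le1 ?ler1n//.
Qed.

End taylor_towers.

(** * Affine maps [x |-> a x + b] acting on directions *)

Section moebius.
Variable R : realType.
Implicit Types (a b r s t y z : R) (P : (R -> R) -> Prop).

Local Notation proj := (@Defs.proj R).

Lemma sin_pi_int (n : int) : sin (pi * n%:~R) = 0 :> R.
Proof.
have sin_nat m : sin (pi * m%:R) = 0 :> R.
  elim: m => [|m IH]; first by rewrite mulr0 sin0.
  by rewrite -natr1 mulrDr mulr1 sinD IH sinpi mul0r mulr0 addr0.
by case: n => n; [exact: sin_nat|rewrite NegzE mulrNz mulrN sinN sin_nat oppr0].
Qed.

Lemma sin_pi_eq0_int r : sin (pi * r) = 0 -> r = (Num.floor r)%:~R.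
Proof.
move=> sr; have /andP[fr rf] := floor_itv r.
have sf : sin (pi * (r - (Num.floor r)%:~R)) = 0.
  by rewrite mulrBr sinB sr sin_pi_int mul0r mulr0 subrr.
apply/eqP; rewrite eq_le fr andbT -subr_le0 leNgt; apply/negP => r0.
suff : 0 < sin (pi * (r - (Num.floor r)%:~R)) by rewrite sf ltxx.
apply: sin_gt0_pi; rewrite mulr_gt0 ?pi_gt0//= gtr_pMr ?pi_gt0//.
by move: rf; rewrite intrD ltrBlDl.
Qed.

Lemma sin_pi_eq0_proj s t : sin (pi * (s - t)) = 0 -> proj s = proj t.
Proof.
move=> /sin_pi_eq0_int e; apply/projP; exists (Num.floor (s - t)).
by rewrite -e addrC subrK.
Qed.

(* The direction (cos (pi y), sin (pi y)) is that of the image of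
   (cos (pi t), sin (pi t)) under the matrix ((a, b), (0, 1)), i.e.
   cot (pi y) = a * cot (pi t) + b. *)
Definition affine_cot a b t y := exists l, [/\ 0 < l,
  l * cos (pi * y) = a * cos (pi * t) + b * sin (pi * t) &
  l * sin (pi * y) = sin (pi * t)].

Lemma affine_cot_refl t : affine_cot 1 0 t t.
Proof. by exists 1; rewrite !mul1r mul0r addr0. Qed.

(** The matrices multiply, and so do the positive scale factors. *)
Lemma affine_cot_comp a b a' b' t y z :
  affine_cot a b t y -> affine_cot a' b' y z ->
  affine_cot (a' * a) (a' * b + b') t z.
Proof.
move=> [l [l0 lc ls]] [k [k0 kc ks]]; exists (l * k); split.
- exact: mulr_gt0.
- by rewrite -mulrA kc mulrDr mulrCA lc mulrCA ls; ring.
- by rewrite -mulrA ks.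
Qed.

(** The two directions are positively proportional, so their cross product [sin (pi * (y - z))]
    vanishes. *)
Lemma affine_cot_proj a b t y z :
  affine_cot a b t y -> affine_cot a b t z -> proj y = proj z.
Proof.
move=> [l [l0 lc ls]] [k [k0 kc ks]]; apply: sin_pi_eq0_proj.
rewrite mulrBr sinB; apply: (mulfI (lt0r_neq0 (mulr_gt0 l0 k0))).
transitivity ((l * sin (pi * y)) * (k * cos (pi * z)) -
              (l * cos (pi * y)) * (k * sin (pi * z))); first by ring.
by rewrite ls ks lc kc mulr0 mulrC subrr.
Qed.

(** * An explicit lift and its derivative *)

Definition mob_dot a b t :=
  cos (pi * t) * (a * cos (pi * t) + b * sin (pi * t)) + sin (pi * t) ^+ 2.

Definition mob_cross a b t :=
  cos (pi * t) * sin (pi * t) -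
  sin (pi * t) * (a * cos (pi * t) + b * sin (pi * t)).

(** Squared length of the image vector; the derivative of the lift is [a] divided by it. *)
Definition mob_norm2 a b t :=
  (a * cos (pi * t) + b * sin (pi * t)) ^+ 2 + sin (pi * t) ^+ 2.

(* cos (pi t) and sin (pi t) pair with their images to the dot and cross products
   above; under b^2 < 4 a the angle between them stays below a right angle. *)
Definition mob a b t := t + atan (mob_cross a b t / mob_dot a b t) / pi.

Lemma neg_discr_gt0 a b : b ^+ 2 < 4 * a -> 0 < a.
Proof. by move=> ab; rewrite -(pmulr_rgt0 _ (_ : 0 < 4))// (le_lt_trans _ ab)// sqr_ge0. Qed.

(** A quadratic form in [cos] and [sin] of negative discriminant [b^2 - 4 a]: complete the
    square. *)
Lemma mob_dot_gt0 a b t : b ^+ 2 < 4 * a -> 0 < mob_dot a b t.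
Proof.
move=> ab; rewrite /mob_dot; have := cos2Dsin2 (pi * t).
move: (cos _) (sin _) => c s cs.
have E : 4 * (c * (a * c + b * s) + s ^+ 2) =
    (4 * a - b ^+ 2) * c ^+ 2 + (b * c + 2 * s) ^+ 2 by ring.
rewrite -(pmulr_rgt0 _ (_ : 0 < 4))// E.
have [c0|c0] := eqVneq c 0.
  by move: cs; rewrite c0 !expr0n mulr0 mulr0 !add0r exprMn => ->; rewrite mulr1 exprn_gt0.
by rewrite ltr_pwDl ?sqr_ge0// mulr_gt0 ?subr_gt0// exprn_even_gt0.
Qed.

(** Lagrange's identity, one of the two vectors having length 1. *)
Lemma mob_norm2E a b t : mob_dot a b t ^+ 2 + mob_cross a b t ^+ 2 = mob_norm2 a b t.
Proof.
rewrite /mob_dot /mob_cross /mob_norm2; have := cos2Dsin2 (pi * t).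
move: (cos _) (sin _) => c s cs.
transitivity (((a * c + b * s) ^+ 2 + s ^+ 2) * (c ^+ 2 + s ^+ 2)); first by ring.
by rewrite cs mulr1.
Qed.

(** As the dot product is positive, [th] is the angle from the vector to its image, and dot product
    over [cos th] is the length of the image. *)
Lemma affine_cot_mob a b t : b ^+ 2 < 4 * a -> affine_cot a b t (mob a b t).
Proof.
move=> ab; have D0 := mob_dot_gt0 t ab; set th := atan (mob_cross a b t / mob_dot a b t).
have cth : 0 < cos th by rewrite cos_atan invr_gt0 sqrtr_gt0 ltr_pwDl ?sqr_ge0.
have sth : sin th = mob_cross a b t / mob_dot a b t * cos th.
  by rewrite -[X in X * _]atanK -/th /tan mulfVK// gt_eqF.
have -> : mob a b t = t + th / pi by [].
have p0 : pi != 0 :> R by rewrite gt_eqF// pi_gt0.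
exists (mob_dot a b t / cos th); split; first exact: divr_gt0.
  rewrite mulrDr (mulrC _ (th / pi)) divfK// cosD sth.
  have := cos2Dsin2 (pi * t).
  move: D0 cth; rewrite /mob_dot /mob_cross; move: (cos (pi * t)) (sin (pi * t)) (cos th).
  move=> c s C D0 C0 cs; transitivity ((a * c + b * s) * (c ^+ 2 + s ^+ 2)).
    by field; rewrite !gt_eqF.
  by rewrite cs mulr1.
rewrite mulrDr (mulrC _ (th / pi)) divfK// sinD sth.
have := cos2Dsin2 (pi * t).
move: D0 cth; rewrite /mob_dot /mob_cross; move: (cos (pi * t)) (sin (pi * t)) (cos th).
move=> c s C D0 C0 cs; transitivity (s * (c ^+ 2 + s ^+ 2)).
  by field; rewrite !gt_eqF.
by rewrite cs mulr1.
Qed.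

Lemma mob_norm2_gt0 a b t : b ^+ 2 < 4 * a -> 0 < mob_norm2 a b t.
Proof.
move=> /(mob_dot_gt0 t) D0.
by rewrite -mob_norm2E ltr_pwDl ?sqr_ge0// exprn_gt0.
Qed.

(** For [q] the quotient cross / dot, [1 + q^2 = norm2 / dot^2] and [q' = pi * (a - norm2) / dot^2];
    so the angle term has derivative [a / norm2 - 1]. *)
Lemma is_derive_mob a b t : b ^+ 2 < 4 * a ->
  is_derive t (1 : R) (mob a b) (a * (mob_norm2 a b t)^-1).
Proof.
move=> ab; have D0 := mob_dot_gt0 t ab.
have dl : is_derive t (1 : R) (fun x => pi * x) pi.
  by apply: is_derive_eq; rewrite /GRing.scale/= mulr1.
have dc : is_derive t (1 : R) (fun x => cos (pi * x)) (- sin (pi * t) * pi).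
  exact: is_derive1_comp (is_derive_cos _) dl.
have ds : is_derive t (1 : R) (fun x => sin (pi * x)) (cos (pi * t) * pi).
  exact: is_derive1_comp (is_derive_sin _) dl.
set c := cos (pi * t) in D0 dc ds *; set s := sin (pi * t) in D0 dc ds *.
pose w := (cst a * (fun x => cos (pi * x)) + cst b * (fun x => sin (pi * x))) : R -> R.
have dw : is_derive t (1 : R) w (pi * (b * c - a * s)).
  have dca := is_deriveM (is_derive_cst a t 1) dc.
  apply: is_derive_eq (is_deriveD dca (is_deriveM (is_derive_cst b t 1) ds)) _.
  by rewrite /GRing.scale/= !mulr0 !addr0; ring.
have dD : is_derive t (1 : R) (mob_dot a b)
    (pi * (c * (b * c - a * s) - s * (a * c + b * s) + 2 * s * c)).
  apply: is_derive_eq (is_deriveD (is_deriveM dc dw) (is_deriveX 2 ds)) _.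
  by rewrite /GRing.scale/= {1}/w !fctE -/c -/s; ring.
have dX : is_derive t (1 : R) (mob_cross a b)
    (pi * (c ^+ 2 - s ^+ 2 - c * (a * c + b * s) - s * (b * c - a * s))).
  apply: is_derive_eq (is_deriveB (is_deriveM dc ds) (is_deriveM ds dw)) _.
  by rewrite /GRing.scale/= {1}/w !fctE -/c -/s; ring.
have dV := is_deriveV (lt0r_neq0 D0) dD.
have dq : is_derive t (1 : R) (fun x => mob_cross a b x / mob_dot a b x)
    (pi * (a - mob_norm2 a b t) / mob_dot a b t ^+ 2).
  have cs := cos2Dsin2 (pi * t); apply: is_derive_eq (is_deriveM dX dV) _; rewrite /GRing.scale /= /mob_norm2.
  move: D0; rewrite /mob_cross /mob_dot -/c -/s => D0.
  rewrite -/c -/s in cs.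
  (* Factors [c^2 + s^2 = 1] are inserted so that the identity holds for all [c] and [s]. *)
  transitivity (pi * ((c ^+ 2 + s ^+ 2) *
      (a * (c ^+ 2 + s ^+ 2) - ((a * c + b * s) ^+ 2 + s ^+ 2))) /
      (c * (a * c + b * s) + s ^+ 2) ^+ 2); first by field; rewrite gt_eqF.
  by rewrite cs mul1r mulr1.
have da := is_derive1_comp (is_derive1_atan _) dq.
have -> : mob a b = id + pi^-1 *: (atan \o (fun x => mob_cross a b x / mob_dot a b x)).
  by apply/funext => x; rewrite /mob [_ / pi]mulrC.
apply: is_derive_eq (is_deriveD (is_derive_id t (1 : R)) (is_deriveZ pi^-1 da)) _.
rewrite /GRing.scale /=.
have p0 : pi != 0 :> R by rewrite gt_eqF// pi_gt0.
have N0 := mob_norm2_gt0 t ab.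
have -> : 1 + (mob_cross a b t / mob_dot a b t) ^+ 2 =
    mob_norm2 a b t / mob_dot a b t ^+ 2.
  by rewrite -mob_norm2E; field; rewrite gt_eqF.
clear - p0 N0 D0; move: pi p0 => p p0.
by field; rewrite p0 !gt_eqF.
Qed.

Lemma homo_mob a b : b ^+ 2 < 4 * a -> {homo mob a b : s t / s < t}.
Proof.
move=> ab s t st.
have df x := is_derive_mob x ab.
have cf : {within `[s, t], continuous (mob a b)}.
  apply: continuous_subspaceT; apply: derivable1_continuous => x.
  by have [] := df x.
have [c _ e] := MVT st (fun x _ => df x) cf.
have a0 := neg_discr_gt0 ab.
by rewrite -subr_gt0 e mulr_gt0 ?subr_gt0// divr_gt0// mob_norm2_gt0.
Qed.

(** A shift by 1 negates both vectors, which preserves their dot and cross products. *)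
Lemma mobD1 a b t : mob a b (t + 1) = mob a b t + 1.
Proof.
rewrite /mob /mob_cross /mob_dot mulrDr mulr1 cosDpi sinDpi addrAC.
by congr (_ + atan (_ / _) / _ + _); ring.
Qed.

Lemma mobD_int a b t (n : int) : mob a b (t + n%:~R) = mob a b t + n%:~R.
Proof.
have nat_case s m : mob a b (s + m%:R) = mob a b s + m%:R.
  by elim: m => [|m IH]; [rewrite !addr0|rewrite -natr1 !addrA mobD1 IH].
case: n => n; first exact: nat_case.
rewrite NegzE mulrNz; apply: (addIr n.+1%:R).
by rewrite -nat_case !subrK.
Qed.

(** * The induced circle maps, their composition and regularity *)

Definition mob_circle a b (x : circle R) : circle R := proj (mob a b (rep x)).

Lemma mob_circle_lift a b : is_lift (mob_circle a b) (mob a b).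
Proof.
move=> t; have [|n e] := (projP (rep (proj t)) t).1; first by rewrite repK.
by rewrite /mob_circle e mobD_int; apply/projP; exists n.
Qed.

(** Both sides solve the same [affine_cot] relation, which determines the point. The condition on
    [a''] and [b''] is separate because composition does not preserve it. *)
Lemma mob_circle_comp a b a' b' a'' b'' x : b ^+ 2 < 4 * a -> b' ^+ 2 < 4 * a' ->
  b'' ^+ 2 < 4 * a'' -> a'' = a' * a -> b'' = a' * b + b' ->
  mob_circle a' b' (mob_circle a b x) = mob_circle a'' b'' x.
Proof.
move=> ab ab' ab'' aE bE; rewrite -(repK x) !mob_circle_lift.
apply: (@affine_cot_proj a'' b'' (rep x)).
  rewrite aE bE; apply: affine_cot_comp; exact: affine_cot_mob.
exact: affine_cot_mob.
Qed.

(** Double angle formulas give the shape handled by [taylor_tower_trig]. *)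
Lemma mob_norm2_trig a b t : mob_norm2 a b t =
  (a ^+ 2 + b ^+ 2 + 1) / 2 + (a ^+ 2 - b ^+ 2 - 1) / 2 * cos (2 * pi * t) +
  a * b * sin (2 * pi * t).
Proof.
have -> : 2 * pi * t = (pi * t) *+ 2 by rewrite -mulrA mulr_natl.
rewrite cos_mulr2n sin_mulr2n cos2sin2 /mob_norm2.
have := cos2sin2 (pi * t).
move: (cos _) (sin _) => c s cs.
transitivity (a ^+ 2 * c ^+ 2 + 2 * a * b * c * s + (b ^+ 2 + 1) * s ^+ 2).
  by ring.
by rewrite cs; field.
Qed.

Lemma mob_norm2V_bound a b t : b ^+ 2 < 4 * a ->
  `|(mob_norm2 a b t)^-1| <= 1 + 2 * (1 + b ^+ 2) / a ^+ 2.
Proof.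
move=> ab; have N0 := mob_norm2_gt0 t ab.
have a0 := neg_discr_gt0 ab.
have a2 : 0 < a ^+ 2 by rewrite exprn_gt0.
rewrite gtr0_norm ?invr_gt0// -[leLHS]mul1r ler_pdivrMr//.
rewrite -(ler_pM2l a2) mulr1 (_ : a ^+ 2 * _ = (a ^+ 2 + 2 * (1 + b ^+ 2)) *
  mob_norm2 a b t); last by field; rewrite gt_eqF.
have := cos2Dsin2 (pi * t); rewrite /mob_norm2; move: (cos _) (sin _) => c s cs.
rewrite -[X in X <= _]mulr1 -[X in a ^+ 2 * X <= _]cs.
(* The square of [a c + 2 b s] is the defect in [(a c)^2 <= 2 (a c + b s)^2 + 2 (b s)^2]. *)
rewrite -subr_ge0 (_ : _ - _ = a ^+ 2 * (a * c + b * s) ^+ 2 +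
  (a * c + 2 * b * s) ^+ 2 + 2 * b ^+ 2 * (a * c + b * s) ^+ 2 + 2 * s ^+ 2).
  by do ?[exact: sqr_ge0|apply: addr_ge0|apply: mulr_ge0].
by ring.
Qed.

Lemma mob_regular a b : b ^+ 2 < 4 * a ->
  real_analytic (mob a b) /\ forall k, is_Ck k (mob a b).
Proof.
move=> ab; have [u [tu bu u0]] := taylor_tower_trig ((a ^+ 2 + b ^+ 2 + 1) / 2)
  ((a ^+ 2 - b ^+ 2 - 1) / 2) (a * b).
have uE t : u 0%N t = mob_norm2 a b t by rewrite u0 mob_norm2_trig.
have [||v [tv bv v0]] := taylor_tower_inv (M := 1 + 2 * (1 + b ^+ 2) / a ^+ 2) tu bu.
- by move=> t; rewrite uE gt_eqF// mob_norm2_gt0.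
- by move=> t; rewrite uE mob_norm2V_bound.
have dmob t : is_derive t (1 : R) (mob a b) (a * v 0%N t).
  by rewrite v0 uE; exact: is_derive_mob.
exact: real_analytic_primitive dmob tv bv.
Qed.

(** The inverse has parameters [1 / a] and [- b / a], whose discriminant condition is the given one
    divided by [a^2]. A general [P] serves both the analytic and the [C^k] case. *)
Lemma op_diffeo_mob_circle a b P : b ^+ 2 < 4 * a ->
  (forall a' b', b' ^+ 2 < 4 * a' -> P (mob a' b')) -> op_diffeo P (mob_circle a b).
Proof.
move=> ab PM.
have a0 := neg_discr_gt0 ab.
have abV : (- b / a) ^+ 2 < 4 * a^-1.
  have -> : (- b / a) ^+ 2 = b ^+ 2 * a ^- 2 by rewrite exprMn sqrrN exprVn.
  have -> : 4 * a^-1 = 4 * a * a ^- 2 by field; rewrite gt_eqF.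
  by rewrite ltr_pM2r// invr_gt0 exprn_gt0.
have op a' b' : b' ^+ 2 < 4 * a' -> op_map P (mob_circle a' b').
  move=> ab'; exists (mob a' b'); split; [exact: mob_circle_lift|exact: homo_mob|exact: PM].
have ab1 : (0 : R) ^+ 2 < 4 * 1 by rewrite expr0n mulr1.
have mob1 (x : circle R) : mob_circle 1 0 x = x.
  rewrite -(repK x) mob_circle_lift. apply: (affine_cot_proj (affine_cot_mob _ ab1)).
  exact: affine_cot_refl.
exists (mob_circle a^-1 (- b / a)); split; [move=> x|move=> x|exact: op|exact: op].
  rewrite (mob_circle_comp _ ab abV ab1) ?mob1 ?mulVf ?gt_eqF//.
  by rewrite mulNr mulrC subrr.
rewrite (mob_circle_comp _ abV ab ab1) ?mob1 ?mulfV ?gt_eqF//.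
by rewrite mulNr mulrN mulrC divfK ?gt_eqF// addrC subrr.
Qed.

(** * Rotation number, fixed point and second derivative *)

Lemma mob0 a b : mob a b 0 = 0.
Proof. by rewrite /mob /mob_cross mulr0 sin0 mulr0 mul0r subrr mul0r atan0 mul0r addr0. Qed.

(** The lift fixes every integer, so each orbit stays between two consecutive integers and its
    displacement is at most 1. *)
Lemma mob_circle_rotation a b : b ^+ 2 < 4 * a -> is_rotation_number (mob_circle a b) 0.
Proof.
move=> ab; exists (mob a b), 0; split; last by rewrite proj0.
- exact: (is_Ck_continuous ((mob_regular ab).2 0%N)).
- exact: mob_circle_lift.
move=> t; have /andP[ft tf] := floor_itv t; set m := Num.floor t in ft tf.
have mobZ (n : int) : mob a b n%:~R = n%:~R by rewrite -[n%:~R]add0r mobD_int mob0.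
have le_mob : {homo mob a b : x y / x <= y}.
  by move=> x y; rewrite le_eqVlt => /orP[/eqP->//|/(homo_mob ab)/ltW].
have bnd n : `|iter n (mob a b) t - t| <= 1.
  have /andP[h1 h2] : m%:~R <= iter n (mob a b) t <= (m + 1)%:~R.
    elim: n => [|n /andP[h1 h2]]; first by rewrite ft ltW.
    by rewrite iterS -(mobZ m) -(mobZ (m + 1)) !le_mob.
  by move: tf h2; rewrite ler_norml intrD; lra.
apply/cvgrPdist_le => e e0; exists (Num.bound e^-1).+1 => // n /= ltn.
have n0 : 0 < n%:R :> R by rewrite ltr0n (leq_trans _ ltn).
rewrite sub0r normrN normrM normfV (gtr0_norm n0) ler_pdivrMr//.
apply: le_trans (bnd n) _; rewrite -ler_pdivrMl// mulr1 ltW//.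
have := archi_boundP (ltW (_ : 0 < e^-1)); rewrite invr_gt0 => /(_ e0) lte.
by apply: lt_le_trans lte _; rewrite ler_nat ltnW.
Qed.

(** At a fixed point the angle is [n * pi]; [atan] stays within [pi / 2], so [n = 0] and the cross
    product, here [- sin^2 (pi t)], vanishes. *)
Lemma mob11_circle_fixed (x : circle R) : mob_circle 1 1 x = x <-> x = proj 0.
Proof.
split=> [|->]; last by rewrite mob_circle_lift mob0.
have ab : 1 ^+ 2 < 4 * 1 :> R by rewrite expr1n mulr1 ltr1n.
rewrite -{1 2 3}(repK x) mob_circle_lift => /projP[n]; rewrite /mob => /addrI e.
set t := rep x in e *.
have p0 := pi_gt0 R.
have n0 : n%:~R = 0 :> R.
  apply/eqP/negPn/negP => /(norm_intr_ge1 (intr_int R n)).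
  have := atan_gtNpi2 (mob_cross 1 1 t / mob_dot 1 1 t).
  have := atan_ltpi2 (mob_cross 1 1 t / mob_dot 1 1 t).
  rewrite -e normrM normfV (gtr0_norm p0) ler_pdivlMr// mul1r => h1 h2.
  by apply/negP; rewrite -ltNge ltr_norml; lra.
move: e; rewrite n0 => /eqP.
rewrite mulf_eq0 invr_eq0 (gt_eqF p0) orbF => /eqP at0.
have := atanK (mob_cross 1 1 t / mob_dot 1 1 t); rewrite at0 tan0 => /esym/eqP.
rewrite mulf_eq0 invr_eq0 (gt_eqF (mob_dot_gt0 t ab)) orbF /mob_cross !mul1r.
rewrite mulrC -mulrBr opprD addrA subrr add0r mulrN oppr_eq0 mulf_eq0 orbb => /eqP.
by move=> s0; apply: sin_pi_eq0_proj; rewrite subr0.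
Qed.

(** The lift has derivative [1 / norm2], and [norm2] has derivative [2 * pi] at 0. *)
Lemma mob11_derive2 : circle_derive 2 (mob_circle 1 1) (proj 0) != 0.
Proof.
have ab : 1 ^+ 2 < 4 * 1 :> R by rewrite expr1n mulr1 ltr1n.
rewrite (circle_deriveE _ _ (mob_circle_lift 1 1))//; last first.
  exact: (is_Ck_continuous ((mob_regular ab).2 0%N)).
rewrite derive1Sn derive1n1 (_ : derive1 (mob 1 1) = fun t => (mob_norm2 1 1 t)^-1); last first.
  apply/funext => t; have dmob := is_derive_mob t ab.
  by rewrite derive1E (@derive_val _ _ _ _ _ _ _ dmob) mul1r.
have N0 := mob_norm2_gt0 0 ab.
have dl : is_derive (0 : R) (1 : R) (fun x => 2 * pi * x) (2 * pi).
  by apply: is_derive_eq; rewrite /GRing.scale/= mulr1.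
have dN : is_derive (0 : R) (1 : R) (mob_norm2 1 1) (2 * pi).
  have dc := is_derive1_comp (is_derive_cos _) dl.
  have ds := is_derive1_comp (is_derive_sin _) dl.
  rewrite (_ : mob_norm2 1 1 = cst (3 / 2) + (- 2^-1) *: (cos \o (fun x => 2 * pi * x)) +
    (sin \o (fun x => 2 * pi * x))).
    apply: is_derive_eq (is_deriveD (is_deriveD (is_derive_cst _ _ _) (is_deriveZ _ dc)) ds) _.
    by rewrite /GRing.scale/= mulr0 sin0 cos0; ring.
  apply/funext => x; rewrite mob_norm2_trig !fctE /GRing.scale/=.
  by congr (_ + _ * _ + _); field.
have dV := is_deriveV (lt0r_neq0 N0) dN; rewrite derive1E (@derive_val _ _ _ _ _ _ _ dV) /GRing.scale /=.
by rewrite mulf_neq0 ?oppr_eq0 ?invr_neq0 ?expf_neq0 ?gt_eqF// mulr_gt0 ?pi_gt0.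
Qed.

(** Both sides are [x |-> 2 x + 2]. The right one is composed starting from [m], because [u ^+ 2]
    has [b^2 = 4 a] and violates the strict condition. *)
Lemma mob_doubling k (u m : Diff R k) :
  u = mob_circle 1 1 :> (circle R -> circle R) ->
  m = mob_circle 2 0 :> (circle R -> circle R) -> (m * u = u ^+ 2 * m)%g.
Proof.
move=> uE mE; rewrite expg2; apply: diff_inj => x.
have -> : (m * u)%g x = m (u x) by [].
have -> : (u * u * m)%g x = u (u (m x)) by [].
have ab1 : 1 ^+ 2 < 4 * 1 :> R by rewrite expr1n mulr1 ltr1n.
have ab2 : (0 : R) ^+ 2 < 4 * 2 by rewrite expr0n mulr_gt0.
have ab3 : 1 ^+ 2 < 4 * 2 :> R by rewrite expr1n; lra.
have ab4 : 2 ^+ 2 < 4 * 2 :> R by lra.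
rewrite uE mE (mob_circle_comp _ ab1 ab2 ab4); [|ring..].
by rewrite (mob_circle_comp _ ab2 ab1 ab3) ?(mob_circle_comp _ ab3 ab1 ab4)//; ring.
Qed.

End moebius.

(** * The map [x |-> x + 1] in the coordinate [cot (pi t)] *)

Theorem proposition1p3 (R : realType) :
  exists f : circle R -> circle R,
    [/\ op_diffeo (@real_analytic R) f,
        is_rotation_number f 0,
        forall k : nat, (1 <= k)%N -> Ck_distorted k f &
        exists x : circle R,
          [set y | f y = y] = [set x] /\ circle_derive 2 f x != 0].
Proof.
have ab : (1 : R) ^+ 2 < 4 * 1 by rewrite expr1n mulr1 ltr1n.
have ab2 : (0 : R) ^+ 2 < 4 * 2 by rewrite expr0n mulr_gt0.
have analytic_mob (a b : R) : b ^+ 2 < 4 * a -> real_analytic (mob a b).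
  by move=> /mob_regular[].
have Ck_mob k (a b : R) : b ^+ 2 < 4 * a -> is_Ck k (mob a b).
  by move=> /mob_regular[].
exists (mob_circle 1 1); split.
- exact: op_diffeo_mob_circle.
- exact: mob_circle_rotation.
- move=> k _; pose u := MkDiff (op_diffeo_mob_circle ab (Ck_mob k)).
  pose m := MkDiff (op_diffeo_mob_circle ab2 (Ck_mob k)).
  by exists u => //; apply: (@distorted_of_doubling _ _ u m); exact: mob_doubling.
exists (Defs.proj 0); split; last exact: mob11_derive2.
by apply/seteqP; split=> x /mob11_circle_fixed.
Qed.
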